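(* Let $G'=(V,F)$ be a chordal graph on $V=\{1,\ldots,n\}$, and let $(C_1,\ldots,C_l)$ be an ordering of all maximal cliques of $G'$ (viewed as vertex sets) satisfying the running intersection property: for every $r=1,\ldots,l-1$ there is $s\ge r+1$ with $C_r\cap(C_{r+1}\cup\cdots\cup C_l)\subsetneq C_s$. For $r=1,\ldots,l-1$ put $U_r=C_r\cap(C_{r+1}\cup C_{r+2}\cup\cdots\cup C_l)$. Let $\bar X$ be a real partial symmetric $n\times n$ matrix whose specified entries are exactly the diagonal entries and the entries $(i,j)$ with $\{i,j\}\in F$, and suppose that $\bar X_{C_rC_r}$ is positive definite for every $r=1,\ldots,l$. Let $\hat X$ be the unique positive definite completion of $\bar X$ of maximum determinant. Then $$\ln\det\hat X=\sum_{r=1}^{l}\ln\det\bar X_{C_rC_r}-\sum_{r=1}^{l-1}\ln\det\bar X_{U_rU_r}.$$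
   Context: A graph is chordal if each of its cycles of length at least 4 has a chord (an edge joining two non-consecutive vertices of the cycle). A partial symmetric matrix is a symmetric matrix in which only some of the entries are specified. A completion of a partial symmetric matrix $\bar X$ is a symmetric matrix of the same size that agrees with $\bar X$ on all specified entries; a positive definite completion is a completion that is positive definite. Under the stated hypotheses a positive definite completion exists, and there is a unique one, $\hat X$, maximizing the determinant among all positive definite completions. For an index set $I\subseteq V$, $\bar X_{II}$ denotes the principal submatrix with rows and columns in $I$; it is fully specified when $I$ is contained in a clique of $G'$. The determinant of the $0\times 0$ matrix is $1$. *)

(* Defs.v *)
From HB Require Import structures.
From mathcomp Require Import all_boot all_order all_algebra.
From mathcomp Require Import reals exp.

Set Implicit Arguments.
Unset Strict Implicit.
Unset Printing Implicit Defensive.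

Import Order.TTheory GRing.Theory Num.Theory.
Local Open Scope ring_scope.

(* A finite simple graph is a symmetric irreflexive relation e on a finType;
   symmetry and irreflexivity are hypotheses of the statements. *)
Section Graphs.
Variables (T : finType) (e : rel T).

(* Since e is irreflexive, e x y already forces x != y. *)
Definition has_chord (c : seq T) : Prop :=
  exists x y, [/\ x \in c, y \in c, e x y, y != next c x & x != next c y].

Definition chordal : Prop :=
  forall c : seq T, ucycle e c -> (4 <= size c)%N -> has_chord c.

Definition clique (A : {set T}) : bool :=
  [forall x in A, forall y in A, (x != y) ==> e x y].

Definition maximal_clique (A : {set T}) : bool := maxset clique A.

(* Members are indexed from 0, so the last one has index l.-1. *)
Section CliqueOrdering.
Variables (l : nat) (C : 'I_l -> {set T}).

Definition maximal_clique_ordering : Prop :=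
  injective C /\ forall A, maximal_clique A <-> exists r, C r = A.

Definition separator (r : 'I_l) : {set T} :=
  C r :&: \bigcup_(s < l | (r < s)%N) C s.

Definition running_intersection : Prop :=
  forall r : 'I_l, (r.+1 < l)%N ->
    exists s : 'I_l, (r < s)%N /\ separator r \proper C s.

End CliqueOrdering.
End Graphs.

Section Matrices.
Variable R : realType.

Definition posdefmx n (A : 'M[R]_n) : Prop :=
  A^T = A /\ forall x : 'cV[R]_n, x != 0 -> 0 < (x^T *m A *m x) 0 0.

(* A partial matrix has entries in option R, None being an unspecified entry. *)
Section PartialMatrices.
Variables (n : nat) (X : 'M[option R]_n).

Definition partial_symmetric : Prop := X^T = X.

Definition specified_on (e : rel 'I_n) : Prop :=
  forall i j, isSome (X i j) = (i == j) || e i j.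

Definition completion (Y : 'M[R]_n) : Prop :=
  Y^T = Y /\ forall i j a, X i j = Some a -> Y i j = a.

Definition posdef_completion (Y : 'M[R]_n) : Prop :=
  completion Y /\ posdefmx Y.

Definition maxdet_completion (Y : 'M[R]_n) : Prop :=
  posdef_completion Y /\
  forall Z, posdef_completion Z -> \det Z <= \det Y.

(* The default value 0 is never used when I is a clique of the graph of
   specified entries. *)
Definition principal_submx (I : {set 'I_n}) : 'M[R]_#|I| :=
  \matrix_(i, j) odflt 0 (X (enum_val i) (enum_val j)).

End PartialMatrices.
End Matrices.

(* Main.v *)
Require Import Defs.
From mathcomp Require Import all_boot all_order all_algebra.
From mathcomp Require Import reals exp.
From mathcomp Require Import ring lra.

Set Implicit Arguments.
Unset Strict Implicit.
Unset Printing Implicit Defensive.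

Import Order.TTheory GRing.Theory Num.Theory.
Local Open Scope ring_scope.

(** Let K be the inverse of the maximizer. Perturbing a pair of unspecified
    entries (i, j), (j, i) changes the determinant to first order by 2 K i j, so
    K vanishes at the unspecified positions. Put S_k = C_k u ... u C_l. If the
    inverse of the principal submatrix on S_r = C_r u S_{r+1} has no entry between
    C_r \ S_{r+1} and S_{r+1} \ C_r, Jacobi's complementary minor identity, applied
    on S_r and on C_r to the same minor of the inverses, gives
    det_{S_r} det_{U_r} = det_{C_r} det_{S_{r+1}}. Passing to S_{r+1} changes that
    inverse only on U_r x U_r, and U_r is contained in a later C_s by running
    intersection, so the sparsity persists and the logarithms telescope. *)

(** * Principal minors as full-size determinants, and their gluing *)

Section Determinants.
Variable F : comUnitRingType.

(** Sylvester's identity: multiplying [L1] by a unipotent block matrix on the right or on the left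
    gives two block triangular matrices, both of determinant [\det L1]. *)
Lemma det_add1_mulC m n (A : 'M[F]_(m, n)) (B : 'M[F]_(n, m)) :
  \det (1%:M + A *m B) = \det (1%:M + B *m A).
Proof.
pose L1 : 'M[F]_(m + n) := block_mx 1%:M (- A) B 1%:M.
have e1 : L1 *m block_mx 1%:M A 0 1%:M = block_mx 1%:M 0 B (1%:M + B *m A).
  by rewrite mulmx_block !(mul1mx, mulmx1, mulmx0, addr0) subrr [B *m A + _]addrC.
have e2 : block_mx 1%:M A 0 1%:M *m L1 = block_mx (1%:M + A *m B) 0 B 1%:M.
  by rewrite mulmx_block !(mul1mx, mulmx1, mul0mx, add0r) addNr.
move: (congr1 determinant e1) (congr1 determinant e2).
by rewrite !det_mulmx !det_ublock !det_lblock !det1 !mulr1 !mul1r => -> ->.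
Qed.

Definition projmx n (S : {set 'I_n}) : 'M[F]_n :=
  \matrix_(i, j) ((i == j) && (i \in S))%:R.

(* Extending by the identity keeps the size n fixed, so that all principal
   minors of M are determinants of n x n matrices. *)
Definition mask n (M : 'M[F]_n) (S : {set 'I_n}) : 'M[F]_n :=
  \matrix_(i, j) if (i \in S) && (j \in S) then M i j else (i == j)%:R.

Variable n : nat.
Implicit Types (M N K : 'M[F]_n) (S P Q A B : {set 'I_n}).

Lemma mul_projmxE S m (M : 'M[F]_(n, m)) i j :
  (projmx S *m M) i j = (i \in S)%:R * M i j.
Proof.
rewrite mxE (bigD1 i) //= mxE eqxx big1 ?addr0 // => k ki.
by rewrite mxE eq_sym (negPf ki) mul0r.
Qed.

Lemma mul_mxprojE S m (M : 'M[F]_(m, n)) i j :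
  (M *m projmx S) i j = M i j * (j \in S)%:R.
Proof.
rewrite mxE (bigD1 j) //= mxE eqxx big1 ?addr0 // => k kj.
by rewrite mxE (negPf kj) mulr0.
Qed.

Lemma projmx_idem S : projmx S *m projmx S = projmx S.
Proof.
apply/matrixP=> i j; rewrite mul_projmxE !mxE.
by case: (i \in S); rewrite ?mul1r ?mul0r // andbF.
Qed.

Lemma projmxC S : projmx (~: S) = 1%:M - projmx S.
Proof.
apply/matrixP=> i j; rewrite !mxE inE.
by case: (i == j); case: (i \in S); rewrite /= ?subrr ?subr0.
Qed.

Lemma maskE M S : mask M S = 1%:M - projmx S + projmx S *m M *m projmx S.
Proof.
apply/matrixP=> i j; rewrite -projmxC -mulmxA [RHS]mxE mul_projmxE mul_mxprojE !mxE inE.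
have [->|ij] := eqVneq i j; case: (_ \in S); case: (_ \in S);
  by rewrite /= ?mul1r ?mul0r ?mulr0 ?mulr1 ?addr0 ?add0r.
Qed.

Lemma mask0 M : mask M set0 = 1%:M.
Proof. by apply/matrixP=> i j; rewrite !mxE !inE. Qed.

Lemma maskT M : mask M setT = M.
Proof. by apply/matrixP=> i j; rewrite !mxE !inE. Qed.

Lemma mask_mask M S P : mask (mask M S) P = mask M (S :&: P).
Proof.
apply/matrixP=> i j; rewrite !mxE !inE.
by do 4 case: (_ \in _).
Qed.

Lemma mask_tr M S : (mask M S)^T = mask M^T S.
Proof. by apply/matrixP=> i j; rewrite !mxE andbC eq_sym. Qed.

(** The projection is idempotent, so Sylvester's identity can move one copy of it across [M]; this
    one-sided form is the one that combines with a product by [M]. *)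
Lemma det_mask_col M S :
  \det (mask M S) = \det (1%:M - projmx S + M *m projmx S).
Proof.
have -> : 1%:M - projmx S + M *m projmx S
   = 1%:M + ((M - 1%:M) *m projmx S) *m projmx S.
  by rewrite -mulmxA projmx_idem mulmxBl mul1mx addrAC addrA.
rewrite det_add1_mulC maskE mulmxA mulmxBr mulmx1 mulmxBl projmx_idem.
by congr (\det _); rewrite addrAC addrA.
Qed.

(* Jacobi's complementary minor identity. *)
Lemma det_mask_invmx M P : M \in unitmx ->
  \det (mask M (~: P)) = \det M * \det (mask (invmx M) P).
Proof.
move=> Mu; rewrite !det_mask_col -det_mulmx projmxC subKr.
by congr (\det _); rewrite [RHS]mulmxDr mulmxA mulmxV // mul1mx addrC.
Qed.

Lemma mulmx_eq_invmx M (v w : 'cV[F]_n) : M \in unitmx ->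
  M *m v = w -> v = invmx M *m w.
Proof. by move=> Mu <-; rewrite mulKmx. Qed.

(** Column [j] of the larger inverse is supported in [A], so in the rows of [A] only entries of [M]
    on [A] x [A] meet it: it also solves the system defining column [j] of the smaller inverse. *)
Lemma invmx_mask_col M S A j :
  mask M S \in unitmx -> mask M A \in unitmx -> A \subset S -> j \in A ->
  (forall m, m \in S :\: A -> invmx (mask M S) m j = 0) ->
  forall i, invmx (mask M A) i j = invmx (mask M S) i j.
Proof.
move=> uS uA sAS jA K0 i.
set K := invmx (mask M S).
have jS := subsetP sAS _ jA.
have MK k : \sum_m mask M S k m * K m j = (k == j)%:R.
  by have /matrixP/(_ k j) := mulmxV uS; rewrite !mxE.
(* Outside [S] the masked row is a unit row, which forces the entry to be that of the identity. *)
have K0' m : m \notin A -> K m j = 0.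
  move=> mA; have [mS|mS] := boolP (m \in S); first by apply: K0; rewrite inE mA.
  have := MK m; rewrite (bigD1 m) //= big1 => [|k km].
    rewrite addr0 mxE (negPf mS) /= eqxx mul1r => ->.
    by case: eqP mA => // ->; rewrite jA.
  by rewrite mxE (negPf mS) /= eq_sym (negPf km) mul0r.
suff /(mulmx_eq_invmx uA)/matrixP/(_ i 0) : mask M A *m col j K = col j 1%:M.
  rewrite !mxE => ->; rewrite (bigD1 j) //= big1 => [|k kj].
    by rewrite !mxE eqxx mulr1 addr0.
  by rewrite !mxE (negPf kj) mulr0.
apply/matrixP=> k z; rewrite !mxE.
have [kA|kA] := boolP (k \in A); last first.
  rewrite (bigD1 k) //= big1 => [|m mk].
    rewrite addr0 !mxE (negPf kA) eqxx mul1r K0' //.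
    by case: eqP kA => // ->; rewrite jA.
  by rewrite !mxE (negPf kA) eq_sym (negPf mk) mul0r.
rewrite -[RHS]MK; apply: eq_bigr => m _; rewrite !mxE kA (subsetP sAS _ kA) /=.
have [mA|/K0'->] := boolP (m \in A); last by rewrite !mulr0.
by rewrite (subsetP sAS _ mA).
Qed.

(** By the vanishing hypothesis, the inverses on [A :|: B] and on [A] agree on [P] x [P], so the
    complementary minors for [B] and [A :&: B] carry the same factor. *)
Lemma det_mask_glue M A B :
  let K := invmx (mask M (A :|: B)) in
  mask M (A :|: B) \in unitmx -> mask M A \in unitmx ->
  (forall i j, i \in B :\: A -> j \in A :\: B -> K i j = 0) ->
  \det (mask M (A :|: B)) * \det (mask M (A :&: B))
    = \det (mask M A) * \det (mask M B).
Proof.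
move=> K uS uA K0; set P := A :\: B.
have -> : A :&: B = A :&: ~: P.
  by apply/setP=> i; rewrite !inE; case: (_ \in A); case: (_ \in B).
have {2}-> : B = (A :|: B) :&: ~: P.
  by apply/setP=> i; rewrite !inE; case: (_ \in A); case: (_ \in B).
rewrite -!mask_mask !det_mask_invmx // mulrCA.
congr (_ * (_ * \det _)); apply/matrixP=> i j; rewrite !mxE.
case: ifP => // /andP[_ jP]; apply: invmx_mask_col => //.
- exact: subsetUl.
- by move: jP; rewrite inE => /andP[].
move=> m; rewrite !inE => /andP[mA /orP[|]]; first by rewrite (negPf mA).
by move=> mB; apply: K0; rewrite // inE mA mB.
Qed.

(** Links masks to genuine submatrices: with [Q] selecting the rows in [S], [Q *m Q^T] is the
    identity and [Q^T *m Q] the projection, and Sylvester's identity changes the size. *)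
Lemma det_principal M (S : {set 'I_n}) :
  \det (mask M S) =
    \det (\matrix_(i < #|S|, j < #|S|) M (enum_val i) (enum_val j)).
Proof.
pose Q : 'M[F]_(#|S|, n) := \matrix_(i, j) (enum_val i == j)%:R.
have QE p (N : 'M[F]_(n, p)) i j : (Q *m N) i j = N (enum_val i) j.
  rewrite mxE (bigD1 (enum_val i)) //= !mxE eqxx mul1r big1 ?addr0 // => k ki.
  by rewrite !mxE eq_sym (negPf ki) mul0r.
have QQT : Q *m Q^T = 1%:M.
  by apply/matrixP=> i j; rewrite QE !mxE (inj_eq enum_val_inj) eq_sym.
have QTQ : Q^T *m Q = projmx S.
  apply/matrixP=> i j; rewrite !mxE.
  have [iS|iS] := boolP (i \in S); last first.
    rewrite andbF big1 // => k _; rewrite !mxE.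
    case: eqP => [ki|]; last by rewrite mul0r.
    by case/negP: iS; rewrite -ki enum_valP.
  rewrite (bigD1 (enum_rank_in iS i)) //= !mxE enum_rankK_in // eqxx mul1r andbT.
  rewrite big1 ?addr0 // => k ki; rewrite !mxE.
  case: eqP => [ek|]; last by rewrite mul0r.
  by case/eqP: ki; apply: enum_val_inj; rewrite enum_rankK_in.
have -> : (\matrix_(i < #|S|, j < #|S|) M (enum_val i) (enum_val j)) = Q *m M *m Q^T.
  apply/matrixP=> i j; rewrite -mulmxA QE -[M *m _]trmxK trmx_mul trmxK.
  by rewrite [RHS]mxE QE !mxE.
have -> : mask M S = 1%:M + Q^T *m ((Q *m M *m Q^T - 1%:M) *m Q).
  by rewrite maskE -QTQ mulmxBl mul1mx mulmxBr !mulmxA addrAC addrA.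
by rewrite det_add1_mulC -mulmxA QQT mulmx1 addrC subrK.
Qed.
End Determinants.

(** * Positive definite matrices *)

Section PositiveDefinite.
Variables (R : realType) (n : nat).
Implicit Types (M : 'M[R]_n) (S : {set 'I_n}) (x : 'cV[R]_n).

Lemma posdefmx_unit M : posdefmx M -> M \in unitmx.
Proof.
case=> Msym Mpos; rewrite -row_free_unit; apply: inj_row_free => v vM0.
apply/eqP; rewrite -trmx_eq0; apply/negPn/negP => /Mpos.
by rewrite trmxK vM0 mul0mx mxE ltxx.
Qed.

Lemma posdefmx_inv M : posdefmx M -> posdefmx (invmx M).
Proof.
move=> Mpd; have Mu := posdefmx_unit Mpd; case: Mpd => Msym Mpos.
split=> [|x x0]; first by rewrite trmx_inv Msym.
have /Mpos : invmx M *m x != 0.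
  by apply: contra_neq x0 => /(congr1 (mulmx M)); rewrite mulKVmx // mulmx0.
by rewrite trmx_mul trmx_inv Msym -!mulmxA mulKVmx.
Qed.

Lemma quad_delta M i j :
  ((delta_mx i 0 : 'cV_n)^T *m M *m (delta_mx j 0 : 'cV_n)) 0 0 = M i j.
Proof. by rewrite trmx_delta -rowE -colE !mxE. Qed.

Lemma posdefmx_diag M i : posdefmx M -> 0 < M i i.
Proof.
case=> _ Mpos; rewrite -(quad_delta M i i); apply: Mpos.
apply/negP => /eqP/matrixP/(_ i 0); rewrite !mxE !eqxx /= => /eqP.
by rewrite oner_eq0.
Qed.

(** The form splits into the squared norm of [x] outside [S] plus the form of [M] on the part of [x]
    inside [S]. *)
Lemma posdefmx_mask M S : posdefmx M -> posdefmx (mask M S).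
Proof.
case=> Msym Mpos; split=> [|x x0]; first by rewrite mask_tr Msym.
have pT P : (projmx R P : 'M_n)^T = projmx R P.
  by apply/matrixP=> i j; rewrite !mxE eq_sym; case: eqP => //= ->.
have -> : (x^T *m mask M S *m x) 0 0 =
    ((projmx R (~: S) *m x)^T *m (projmx R (~: S) *m x)) 0 0
    + ((projmx R S *m x)^T *m M *m (projmx R S *m x)) 0 0.
  rewrite maskE -projmxC -{1}(projmx_idem R (~: S)) !trmx_mul !pT.
  by rewrite mulmxDr mulmxDl !mulmxA [LHS]mxE.
have sq0 (y : 'cV[R]_n) : 0 <= (y^T *m y) 0 0.
  by rewrite mxE sumr_ge0 // => k _; rewrite mxE -expr2 sqr_ge0.
have [Dx|/Mpos Dx] := eqVneq (projmx R S *m x) 0; last by rewrite ltr_wpDl.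
have Ex : projmx R (~: S) *m x = x by rewrite projmxC mulmxBl mul1mx Dx subr0.
rewrite Dx Ex mulmx0 [X in _ + X]mxE addr0 lt_def sq0 andbT.
apply: contra_neq x0; rewrite mxE => /eqP.
rewrite psumr_eq0 => [|k _]; last by rewrite mxE -expr2 sqr_ge0.
move=> /allP x0; apply/colP=> k; have := x0 k (mem_index_enum k).
by rewrite !mxE mulf_eq0 orbb => /eqP.
Qed.

(** Induction on the size of a masked set: by Jacobi's identity, deleting an index multiplies the
    minor by a diagonal entry of the inverse, which is positive. *)
Lemma posdefmx_det M : posdefmx M -> 0 < \det M.
Proof.
move=> Mpd; rewrite -(maskT M); move: [set: 'I_n] => S.
have [k] := ubnP #|S|; elim: k S => // k IHk S; rewrite ltnS => leSk.
have [->|[i iS]] := set_0Vmem S; first by rewrite mask0 det1.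
have SMpd := posdefmx_mask S Mpd.
have Kpd := posdefmx_inv SMpd.
have := det_mask_invmx [set i] (posdefmx_unit SMpd).
rewrite mask_mask; set d := \det (mask (invmx _) _).
have -> : d = invmx (mask M S) i i.
  rewrite /d (_ : mask _ _ =
      diag_mx (\row_j if j == i then invmx (mask M S) i i else 1)).
    rewrite det_diag (bigD1 i) //= !mxE eqxx big1 ?mulr1 // => j ji.
    by rewrite !mxE (negPf ji).
  apply/matrixP=> j m; rewrite !mxE !inE.
  have [->|ji] := eqVneq j i; have [->|mi] /= := eqVneq m i; rewrite ?eqxx //.
move=> e; have := IHk (S :&: ~: [set i]).
rewrite e pmulr_lgt0 ?posdefmx_diag //; apply; apply: leq_trans leSk.
by rewrite -setDE (cardsD1 i S) iS.
Qed.

(* Cauchy-Schwarz for the form M, applied to x and column i of the inverse. *)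
Lemma sqr_coord_le M x i : posdefmx M ->
  x i 0 ^+ 2 <= invmx M i i * (x^T *m M *m x) 0 0.
Proof.
move=> Mpd; have Mu := posdefmx_unit Mpd.
have a0 := posdefmx_diag i (posdefmx_inv Mpd).
case: Mpd => Msym Mpos; set a := invmx M i i in a0 *; set q := (_ *m x) 0 0.
pose y : 'cV_n := x - (x i 0 / a) *: (invmx M *m delta_mx i 0).
have y0 : 0 <= (y^T *m M *m y) 0 0.
  have [->|] := eqVneq y 0; last by move/Mpos/ltW.
  by rewrite mulmx0 mxE lexx.
have qE : (y^T *m M *m y) 0 0 = q - x i 0 ^+ 2 / a.
  have e1 : M *m y = M *m x - (x i 0 / a) *: delta_mx i 0.
    by rewrite mulmxBr -scalemxAr mulKVmx.
  have e2 : y^T *m M *m x = x^T *m M *m x - (x i 0 / a) *: (delta_mx i 0)^T *m x.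
    rewrite /y linearB /= linearZ /= trmx_mul trmx_inv Msym !mulmxBl.
    by rewrite -!scalemxAl mulmxKV.
  rewrite -mulmxA e1 mulmxBr mulmxA e2 -scalemxAr.
  have subE (A B : 'M[R]_1) : (A - B) 0 0 = A 0 0 - B 0 0 by rewrite !mxE.
  have scaleE c (A : 'M[R]_1) : (c *: A) 0 0 = c * A 0 0 by rewrite mxE.
  have yi : (y^T *m (delta_mx i 0 : 'cV_n)) 0 0 = x i 0 - x i 0 / a * a.
    by rewrite -colE /y -colE !mxE.
  rewrite -scalemxAl trmx_delta -rowE !(subE, scaleE) yi [row i x 0 0]mxE -/q.
  by field; rewrite gt_eqF.
by move: y0; rewrite qE subr_ge0 ler_pdivrMr // mulrC.
Qed.

(** * Symmetric perturbations and stationarity at a determinant maximizer *)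

Lemma det_mx22 (B : 'M[R]_2) : \det B = B 0 0 * B 1 1 - B 0 1 * B 1 0.
Proof.
rewrite (expand_det_row _ 0) !big_ord_recl big_ord0 addr0 /cofactor !det_mx11 !mxE.
rewrite /= !expr0 !expr1 !mul1r mulN1r mulrN.
by congr (B _ _ * B _ _ - B _ _ * B _ _); apply/val_inj.
Qed.

Definition sym_delta_mx (i j : 'I_n) : 'M[R]_n := delta_mx i j + delta_mx j i.

Lemma quad_sym_delta i j x :
  (x^T *m sym_delta_mx i j *m x) 0 0 = x i 0 * x j 0 *+ 2.
Proof.
have dE k m : (x^T *m delta_mx k m *m x) 0 0 = x k 0 * x m 0.
  rewrite -(mul_delta_mx (0 : 'I_1)) mulmxA -colE -mulmxA -rowE mxE big_ord1.
  by rewrite !mxE.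
by rewrite /sym_delta_mx mulmxDr mulmxDl mxE !dE [x j 0 * _]mulrC mulr2n.
Qed.

(** The perturbation has the rank-two factorization [W *m V], so Sylvester's identity leaves a 2 x 2
    determinant in entries of the inverse. *)
Lemma det_sym_perturb M i j t : posdefmx M ->
  \det (M + t *: sym_delta_mx i j) = \det M *
    ((1 + t * invmx M i j) ^+ 2 - t ^+ 2 * (invmx M i i * invmx M j j)).
Proof.
move=> Mpd; have Mu := posdefmx_unit Mpd; set K := invmx M.
have Ksym k m : K k m = K m k.
  by have [/matrixP/(_ m k)+ _] := posdefmx_inv Mpd; rewrite mxE.
pose W : 'M[R]_(n, 2) := \matrix_(k, b) (k == if b == 0 then i else j)%:R.
pose V : 'M[R]_(2, n) := \matrix_(b, k) (k == if b == 0 then j else i)%:R.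
have WV : sym_delta_mx i j = W *m V.
  apply/matrixP=> k m; rewrite /sym_delta_mx !mxE !big_ord_recl big_ord0 addr0.
  by rewrite !mxE /= -!natrM !mulnb.
have VW : V *m (K *m W) = \matrix_(b, c)
    K (if b == 0 then j else i) (if c == 0 then i else j).
  apply/matrixP=> b c; rewrite [RHS]mxE mxE.
  set p := if b == 0 then j else i; set q := if c == 0 then i else j.
  rewrite (bigD1 p) //= big1 => [|k kp]; last by rewrite !mxE (negPf kp) mul0r.
  rewrite addr0 !mxE eqxx mul1r (bigD1 q) //= big1 => [|k kq].
    by rewrite !mxE eqxx mulr1 addr0.
  by rewrite !mxE (negPf kq) mulr0.
have -> : M + t *: sym_delta_mx i j = M *m (1%:M + (t *: (K *m W)) *m V).
  by rewrite mulmxDr mulmx1 -scalemxAl -scalemxAr -mulmxA mulKVmx // WV.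
rewrite det_mulmx det_add1_mulC -scalemxAr VW det_mx22 !mxE /=.
by rewrite [K j i]Ksym; congr (_ * _); ring.
Qed.

(** The added term is controlled by 2 |x_i x_j| <= x_i^2 + x_j^2, where each square is bounded by
    [sqr_coord_le]. *)
Lemma posdefmx_sym_perturb M i j t : posdefmx M ->
  `|t| * (invmx M i i + invmx M j j) < 1 -> posdefmx (M + t *: sym_delta_mx i j).
Proof.
move=> Mpd ht; split=> [|x x0].
  rewrite linearD linearZ /= Mpd.1 /sym_delta_mx linearD /= !trmx_delta.
  by rewrite [delta_mx j i + _]addrC.
rewrite mulmxDr mulmxDl -scalemxAr -scalemxAl mxE [X in _ + X]mxE quad_sym_delta.
have q0 := Mpd.2 x x0; set q := (_ *m x) 0 0 in q0 *.
have hi := sqr_coord_le x i Mpd; have hj := sqr_coord_le x j Mpd.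
rewrite -/q in hi hj.
have le2 : `|x i 0 * x j 0 *+ 2| <= (invmx M i i + invmx M j j) * q.
  apply: (@le_trans _ _ (x i 0 ^+ 2 + x j 0 ^+ 2)); last by rewrite mulrDl lerD.
  rewrite ler_norml; apply/andP; split.
    have := sqr_ge0 (x i 0 + x j 0); nra.
  have := sqr_ge0 (x i 0 - x j 0); nra.
rewrite -[t * _]opprK subr_gt0; apply: le_lt_trans (ler_norm _) _; rewrite normrN normrM.
apply: le_lt_trans (ler_wpM2l (normr_ge0 t) le2) _.
by rewrite mulrA -[ltRHS]mul1r ltr_pM2r.
Qed.

(* For small t, det (M + t (E_ij + E_ji)) / det M = 1 + 2 t k + O(t^2) with
   k the (i, j) entry of the inverse; the witness t = k / D is small enough for
   both positive definiteness and domination of the quadratic term. *)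
Lemma invmx_eq0_max_det M i j : posdefmx M ->
  (forall t, posdefmx (M + t *: sym_delta_mx i j) ->
     \det (M + t *: sym_delta_mx i j) <= \det M) ->
  invmx M i j = 0.
Proof.
move=> Mpd Mmax; have Kpd := posdefmx_inv Mpd.
have a0 := posdefmx_diag i Kpd; have b0 := posdefmx_diag j Kpd.
set a := invmx M i i in a0 *; set b := invmx M j j in b0 *.
set k := invmx M i j; apply/eqP; apply/negPn/negP => k0.
have nk0 : 0 < `|k| by rewrite normr_gt0.
pose D := 1 + a * b + `|k| * (a + b).
have D0 : 0 < D by rewrite /D !addr_gt0 ?mulr_gt0 ?addr_gt0.
have tpd : posdefmx (M + (k / D) *: sym_delta_mx i j).
  apply: posdefmx_sym_perturb => //; rewrite normrM normfV (gtr0_norm D0) -/a -/b.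
  rewrite mulrAC ltr_pdivrMr // mul1r /D ltrDr addr_gt0 ?mulr_gt0 //.
have := Mmax _ tpd; rewrite det_sym_perturb // -/a -/b -/k.
rewrite -[leRHS]mulr1 ler_pM2l ?posdefmx_det // leNgt => /negP; apply.
(* In this form the factor visibly exceeds 1, because [a * b < D]. *)
have -> : (1 + k / D * k) ^+ 2 - (k / D) ^+ 2 * (a * b)
   = 1 + k ^+ 2 / D ^+ 2 * (2 * D + k ^+ 2 - a * b).
  by field; rewrite gt_eqF.
have k2 : 0 < k ^+ 2 by rewrite exprn_even_gt0.
rewrite ltrDl mulr_gt0 //; first by rewrite (divr_gt0 k2) ?exprn_gt0.
have : a * b < D by rewrite /D addrAC ltrDr addr_gt0 ?mulr_gt0 ?addr_gt0.
lra.
Qed.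
End PositiveDefinite.

(** * Tail unions of the clique ordering and sparsity of inverses *)

(** The sets S_k of the overview; [k] is a natural number so that [k = l] is allowed and ends the
    telescoping with the empty set. *)
Definition tail_union (T : finType) l (C : 'I_l -> {set T}) (k : nat) : {set T} :=
  \bigcup_(s < l | (k <= s)%N) C s.

Lemma mem_tail_union (T : finType) l (C : 'I_l -> {set T}) k (t : 'I_l) i :
  (k <= t)%N -> i \in C t -> i \in tail_union C k.
Proof. by move=> kt it; apply/bigcupP; exists t. Qed.

Lemma tail_unionS (T : finType) l (C : 'I_l -> {set T}) (r : 'I_l) :
  tail_union C r = C r :|: tail_union C r.+1.
Proof.
rewrite /tail_union (bigD1 r) //=; congr (_ :|: _); apply: eq_bigl => s.
by rewrite [in RHS]ltn_neqAle andbC eq_sym.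
Qed.

Lemma tail_union_size (T : finType) l (C : 'I_l -> {set T}) :
  tail_union C l = set0.
Proof. by apply: big_pred0 => s; rewrite leqNgt ltn_ord. Qed.

Lemma clique2 (T : finType) (e : rel T) i j :
  symmetric e -> e i j -> clique e [set i; j].
Proof.
move=> e_sym eij; apply/'forall_in_'forall_in_implyP => x + y.
by rewrite !inE => /orP[]/eqP-> /orP[]/eqP->; rewrite ?eqxx // e_sym.
Qed.

(** The pair is a clique and extends to a maximal one. The case [i = j] shows that the cliques cover
    all vertices. *)
Lemma edge_in_member (T : finType) (e : rel T) l (C : 'I_l -> {set T}) i j :
  symmetric e -> maximal_clique_ordering e C -> (i == j) || e i j ->
  exists t, i \in C t /\ j \in C t.
Proof.
move=> e_sym [_ Cmax] ij.
have /maxset_exists[A Amax /subsetP sA] : clique e [set i; j].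
  case/orP: ij => [/eqP->|]; last exact: clique2.
  apply/'forall_in_'forall_in_implyP => x + y.
  by rewrite !inE !orbb => /eqP-> /eqP->; rewrite eqxx.
have [/(_ Amax)[t Ct] _] := Cmax A; exists t; rewrite Ct.
by split; apply: sA; rewrite !inE eqxx ?orbT.
Qed.

(* The running intersection property lets the sparsity pattern survive the
   elimination of C_r: the fill-in lies in the separator, hence in a later C_s. *)
Lemma invmx_tail_pattern (R : realType) n l (C : 'I_l -> {set 'I_n}) (M : 'M[R]_n) :
  running_intersection C -> posdefmx M -> tail_union C 0 = setT ->
  (forall i j, i != j -> invmx M i j != 0 -> exists t, i \in C t /\ j \in C t) ->
  forall k, (k <= l)%N -> forall i j,
  i \in tail_union C k -> j \in tail_union C k -> i != j ->
  invmx (mask M (tail_union C k)) i j != 0 ->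
  exists t : 'I_l, [/\ (k <= t)%N, i \in C t & j \in C t].
Proof.
move=> rip Mpd C0 K0; elim=> [_ i j _ _ ij|r IH rl].
  by rewrite C0 maskT => /(K0 _ _ ij)[t []]; exists t.
have {}IH := IH (ltnW rl); pose o := Ordinal rl.
have SE := tail_unionS C o; rewrite /= in SE.
(* If [j] is not in C_r, every clique witnessing an entry of column [j] has index above r. The
   column is then supported in S_{r+1} and survives the elimination unchanged. *)
have half i j : i \in tail_union C r.+1 -> j \in tail_union C r.+1 -> i != j ->
    j \notin C o -> invmx (mask M (tail_union C r.+1)) i j != 0 ->
    exists t : 'I_l, [/\ (r < t)%N, i \in C t & j \in C t].
  move=> iS jS ij jC.
  have up m : m \in tail_union C r.+1 -> m \in tail_union C r.
    by rewrite SE inE => ->; rewrite orbT.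
  have later m : m \in tail_union C r -> m != j ->
      invmx (mask M (tail_union C r)) m j != 0 ->
      exists t : 'I_l, [/\ (r < t)%N, m \in C t & j \in C t].
    move=> mS mj /(IH _ _ mS (up _ jS) mj)[t [rt mt jt]]; exists t; split=> //.
    rewrite ltn_neqAle rt andbT; apply: contraNneq jC => e.
    by rewrite (_ : o = t) //; apply: val_inj.
  rewrite (@invmx_mask_col _ _ M (tail_union C r)) ?posdefmx_unit //.
  - exact/later/ij/up.
  - exact: posdefmx_mask.
  - exact: posdefmx_mask.
  - by apply/subsetP.
  move=> m; rewrite inE => /andP[mS' mS]; apply/eqP/negPn/negP => Kmj.
  have mj : m != j by apply: contraNneq mS' => ->.
  have [t [rt mt _]] := later m mS mj Kmj.
  by rewrite (mem_tail_union rt mt) in mS'.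
move=> i j iS jS ij Kij.
have [jC|jC] := boolP (j \in C o); last exact: half.
have [iC|iC] := boolP (i \in C o); last first.
  have Ksym := posdefmx_inv (posdefmx_mask (tail_union C r.+1) Mpd).
  have [|||||t [rt jt it]] := half j i => //; last by exists t.
  - by rewrite eq_sym.
  - by move: Kij; rewrite -{1}Ksym.1 mxE.
(* Both indices now lie in the separator; [i] belonging to a later clique shows that r is not the
   last index. *)
have /rip[s [rs /proper_sub/subsetP sub]] : (o.+1 < l)%N.
  by case/bigcupP: iS => s rs _; apply: leq_ltn_trans rs _.
by exists s; split=> //; apply: sub; rewrite inE ?iC ?jC.
Qed.

(** * Telescoping the determinant along the clique ordering *)

Theorem mainTheorem1 (R : realType) (n : nat) (e : rel 'I_n)
    (e_sym : symmetric e) (e_irr : irreflexive e) (e_chordal : chordal e)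
    (l : nat) (C : 'I_l -> {set 'I_n})
    (C_ordering : maximal_clique_ordering e C)
    (C_rip : running_intersection C)
    (X : 'M[option R]_n)
    (X_sym : partial_symmetric X) (X_spec : specified_on X e)
    (X_pos : forall r : 'I_l, posdefmx (principal_submx X (C r)))
    (Xhat : 'M[R]_n) (Xhat_max : maxdet_completion X Xhat) :
  ln (\det Xhat) =
    \sum_(r < l) ln (\det (principal_submx X (C r)))
    - \sum_(r < l | (r.+1 < l)%N)
        ln (\det (principal_submx X (separator C r))).
Proof.
have [[[_ Xhat_ext] Xhat_pd] max_det] := Xhat_max.
pose S := tail_union C.
have C_clique r x y : x \in C r -> y \in C r -> (x == y) || e x y.
  have [_ /(_ (C r))[_ /(_ (ex_intro _ r erefl))/maxsetP[+ _]]] := C_ordering.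
  by move=> /'forall_in_'forall_in_implyP h xC yC; case: eqVneq => //= xy; apply: h.
(* Inside a clique all entries are specified, so the default 0 is never read. *)
have detX r (I : {set 'I_n}) : I \subset C r ->
    \det (principal_submx X I) = \det (mask Xhat I).
  move=> /subsetP IC; rewrite det_principal; congr (\det _).
  apply/matrixP=> i j; rewrite !mxE.
  have := X_spec (enum_val i) (enum_val j).
  rewrite (C_clique r) ?IC ?enum_valP //.
  by case E: (X _ _) => [a|] //= _; rewrite (Xhat_ext _ _ _ E).
have K0 i j : i != j -> invmx Xhat i j != 0 -> exists t, i \in C t /\ j \in C t.
  move=> ij Kij; apply: (edge_in_member e_sym C_ordering).
  (* At an unspecified position the perturbed matrix is still a completion, so maximality applies as
     soon as it is positive definite. *)
  apply: contraNT Kij => nij; apply/eqP; apply: invmx_eq0_max_det => // t tpd.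
  apply: max_det; split=> //; split=> [|x y a Xxy]; first by case: tpd.
  have exy : (x == y) || e x y by rewrite -X_spec Xxy.
  rewrite !mxE (Xhat_ext _ _ _ Xxy).
  have -> : (x == i) && (y == j) = false.
    by apply: contraNF nij => /andP[/eqP<- /eqP<-].
  have -> : (x == j) && (y == i) = false.
    by apply: contraNF nij => /andP[/eqP<- /eqP<-]; rewrite eq_sym e_sym.
  by rewrite addr0 mulr0 addr0.
have S0 : S 0%N = setT.
  apply/setP=> i; rewrite inE.
  have [|t [it _]] := @edge_in_member _ e _ _ i i e_sym C_ordering.
    by rewrite eqxx.
  exact: mem_tail_union it.
have maskpd I := posdefmx_mask I Xhat_pd.
have det0 I : 0 < \det (mask Xhat I) := posdefmx_det (maskpd I).
pose F k := ln (\det (mask Xhat (S k))).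
have step r : ln (\det (mask Xhat (C r))) - ln (\det (mask Xhat (separator C r)))
    = F r - F r.+1.
  apply/eqP; rewrite subr_eq addrAC eq_sym subr_eq -!lnM ?posrE // eq_sym.
  apply/eqP; congr ln; rewrite /S tail_unionS -det_mask_glue ?posdefmx_unit //.
  move=> i j; rewrite !inE => /andP[iC iS] /andP[jS jC].
  (* A nonzero entry would put [i] and [j] in a common C_t with t >= r; t = r contradicts [iC], and
     t > r contradicts [jS]. *)
  apply/eqP/negPn/negP; rewrite -tail_unionS => Kij.
  have [|||t [rt it jt]] :=
    invmx_tail_pattern C_rip Xhat_pd S0 K0 (ltnW (ltn_ord r)) _ _ _ Kij.
  - by rewrite tail_unionS inE iS orbT.
  - by rewrite tail_unionS inE jC.
  - by apply: contraNneq iC => ->.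
  move: rt; rewrite leq_eqVlt => /orP[/eqP/val_inj rt|rt].
    by rewrite rt it in iC.
  by rewrite (mem_tail_union rt jt) in jS.
(* The last index can be added to the sum: its separator is empty and contributes ln 1 = 0. *)
have -> : \sum_(r < l | (r.+1 < l)%N) ln (\det (principal_submx X (separator C r)))
    = \sum_(r < l) ln (\det (mask Xhat (separator C r))).
  rewrite big_mkcond /=; apply: eq_bigr => r _; case: ifPn => [_|].
    by rewrite (detX r) ?subsetIl.
  rewrite -leqNgt => lr; have lr1 : r.+1 = l by apply/anti_leq; rewrite ltn_ord.
  by rewrite /separator -/(tail_union C r.+1) lr1 tail_union_size setI0 mask0 det1 ln1.
under eq_bigr => r _ do rewrite (detX r) //.
rewrite -sumrB; under eq_bigr => r _ do rewrite step -[_ - _]opprB.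
rewrite sumrN -(big_mkord xpredT (fun r => F r.+1 - F r)) telescope_sumr //.
by rewrite opprB /F S0 maskT /S tail_union_size mask0 det1 ln1 subr0.
Qed.
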